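(* Let $Y$ be a Gromov hyperbolic space, $X=\partial_\infty Y$, and let $M$ be the map on the set $\mathcal P_4$ of admissible 4-tuples of $X$ given by $$M(P)=\frac1{|S_4|}\sum_{\rho\in S_4}\operatorname{sign}(\rho)\,\varphi(\rho^{-1})\,\widetilde M(\rho(P)),$$ where $\widetilde M$ is defined from the suprema of lower limits of cross-differences of sequences as in the context. Then $M$ is a sub-Möbius structure on $X$, it is independent of the choice of the base point $o\in Y$, and it is invariant under isometries of $Y$: $M(\gamma(P))=M(P)$ for every isometry $\gamma:Y\to Y$ extended to $\partial_\infty Y$ and every $P\in\mathcal P_4$.
   Context: Tuples. For a set $X$, a 4-tuple in $X^4$ is admissible if no element occurs three or four times among its entries, nondegenerate if its entries are pairwise distinct. $\mathcal P_4$ is the set of ordered admissible 4-tuples, $L_4=\{(a,b,c)\in\mathbb R^3:a+b+c=0\}$, $\overline L_4=L_4\cup\{(0,\infty,-\infty),(-\infty,0,\infty),(\infty,-\infty,0)\}$. Permutations are written $\pi=i_1\dots i_k$ with $i_j=\pi(j)$. $S_4$ acts on $\mathcal P_4$ by $\pi(x_1,x_2,x_3,x_4)=(x_{\pi(1)},\dots,x_{\pi(4)})$, and $\sigma v=(v_{\sigma(1)},v_{\sigma(2)},v_{\sigma(3)})$ for $\sigma\in S_3$, $v\in\overline L_4$. $\varphi:S_4\to S_3$ is the homomorphism with kernel $\{1234,2143,4321,3412\}$ and $\varphi(2134)=132$, $\varphi(3214)=321$, $\varphi(4231)=213$, $\varphi(2431)=231$, $\varphi(3241)=312$. A sub-Möbius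 structure on $X$ is a map $M:\mathcal P_4\to\overline L_4$ such that: (a) $M(\pi P)=\operatorname{sign}(\pi)\varphi(\pi)M(P)$ for all $P\in\mathcal P_4$, $\pi\in S_4$ (with $-(\pm\infty)=\mp\infty$); (b) $M(P)\in L_4$ iff $P$ is nondegenerate; (c) $M(x_1,x_1,x_3,x_4)=(0,\infty,-\infty)$ for every $(x_1,x_1,x_3,x_4)\in\mathcal P_4$. Definition of $\widetilde M$. $(y|y')_o=\frac12(|yo|+|y'o|-|yy'|)$ is the Gromov product of $y,y'\in Y$ with respect to $o\in Y$; points of $\partial_\infty Y$ are equivalence classes of sequences in $Y$ converging to infinity. For $(\alpha,\beta,\gamma,\delta)\in\mathcal P_4$ put $$\operatorname{cd}(\alpha,\beta,\gamma,\delta)=\sup\liminf_i\big[(a_i|d_i)_o+(b_i|c_i)_o-(a_i|c_i)_o-(b_i|d_i)_o\big],$$ the supremum over all sequences $\{a_i\}\in\alpha$, $\{b_i\}\in\beta$, $\{c_i\}\in\gamma$, $\{d_i\}\in\delta$ (if an entry occurs twice, the same sequence is used for both occurrences). Put $\widetilde M(\alpha,\beta,\gamma,\delta)=(\tilde u,\tilde v,-\tilde u-\tilde v)$ with $\tilde u=\operatorname{cd}(\alpha,\beta,\gamma,\delta)$, $\tilde v=\operatorname{cd}(\alpha,\gamma,\delta,\beta)$. For a degenerate $P=(x_1,x_2,x_3,x_4)\in\mathcal P_4$, $\widetilde M(P)$ is understood as $(0,\infty,-\infty)$ if $x_1=x_2$ or $x_3=x_4$; $(-\infty,0,\infty)$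 if $x_1=x_3$ or $x_2=x_4$; $(\infty,-\infty,0)$ if $x_1=x_4$ or $x_2=x_3$. Averages of equal infinite vectors are that vector. *)

(* Defs.v *)
From HB Require Import structures.
From mathcomp Require Import all_boot all_order all_fingroup all_algebra.
From mathcomp Require Import all_classical all_reals all_analysis.

Set Implicit Arguments.
Unset Strict Implicit.
Unset Printing Implicit Defensive.

Import Order.TTheory GRing.Theory Num.Theory.
Import numFieldNormedType.Exports.

Definition perm_act (n : nat) (T : Type) (s : 'S_n) (x : n.-tuple T) :
  n.-tuple T := [tuple tnth x (s i) | i < n].

(* One-line notation with entries counted from 1. *)
Definition oneline (n : nat) (s : 'S_n) : seq nat :=
  [seq (val (s i)).+1 | i <- enum 'I_n].

(* Index of the splitting of {0, 1, 2, 3} into two pairs that contains {a, b};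
   the splittings 01|23, 02|13, 03|12 are numbered 0, 1, 2. *)
Definition pairing_index (a b : 'I_4) : 'I_3 :=
  inord (if (val a == 0) || (val b == 0) then (a + b).-1 else 5 - (a + b)).

(* phi is the action of S_4 on the three splittings into pairs; the splitting
   numbered k is the one containing {0, k + 1}.  The lemmas phiM, phi_ker and
   phi_val below are the properties which determine phi. *)
Definition phi_fun (s : 'S_4) (k : 'I_3) : 'I_3 :=
  pairing_index (s ord0) (s (lift ord0 k)).

Lemma pairing_index_act (s : 'S_4) (a b : 'I_4) : a != b ->
  phi_fun s (pairing_index a b) = pairing_index (s a) (s b).
Proof.
pose o (k : nat) : 'I_4 := inord k.
have oE (x : 'I_4) : x = o x by rewrite /o inord_val.
have L (k : nat) : (k < 3) -> lift (o 0) (inord k : 'I_3) = o k.+1.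
  by move=> k3; apply/val_inj; rewrite /= /bump !inordK.
have sne i j : (i < 4) -> (j < 4) -> i != j ->
    (val (s (o i)) != val (s (o j))).
  move=> i4 j4 ij; rewrite (inj_eq val_inj) (inj_eq perm_inj).
  by rewrite -(inj_eq val_inj) /= !inordK.
have H01 := sne 0 1 isT isT isT; have H02 := sne 0 2 isT isT isT.
have H03 := sne 0 3 isT isT isT; have H12 := sne 1 2 isT isT isT.
have H13 := sne 1 3 isT isT isT; have H23 := sne 2 3 isT isT isT.
have e0 : ord0 = o 0 by apply/val_inj; rewrite /= inordK.
rewrite (oE a) (oE b) /phi_fun e0 => ab.
have {ab} : (val a != val b) by apply: contraNneq ab => ->.
have P (i j k : nat) : (i < 4) -> (j < 4) ->
    (if (i == 0) || (j == 0) then (i + j).-1 else 5 - (i + j)) = k ->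
    pairing_index (o i) (o j) = inord k.
  by move=> i4 j4; rewrite /pairing_index /= !inordK // => ->.
case: a b => [a a4] [b b4] /= ab.
case: a b a4 b4 ab => [|[|[|[|a]]]] [|[|[|[|b]]]] a4 b4 //= _;
  rewrite (P _ _ _ a4 b4 erefl) L //=; rewrite /pairing_index;
  congr (inord _);
  move: (s (o 0)) (s (o 1)) (s (o 2)) (s (o 3)) H01 H02 H03 H12 H13 H23;
  by do 4! case=> [[|[|[|[|?]]]] ?] //.
Qed.

Lemma pairing_index0 (k : 'I_3) : pairing_index ord0 (lift ord0 k) = k.
Proof.
by apply/val_inj; rewrite /pairing_index /= /bump /= add0n inordK.
Qed.

Lemma phi_funM (s t : 'S_4) (k : 'I_3) :
  phi_fun (s * t)%g k = phi_fun t (phi_fun s k).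
Proof.
by rewrite [phi_fun s k]/phi_fun pairing_index_act ?(inj_eq perm_inj) //
           /phi_fun !permM.
Qed.

Lemma phi_fun_inj (s : 'S_4) : injective (phi_fun s).
Proof.
apply: (can_inj (g := phi_fun s^-1)) => k.
by rewrite -phi_funM mulgV /phi_fun !perm1 pairing_index0.
Qed.

Definition phi (s : 'S_4) : 'S_3 := perm (@phi_fun_inj s).

Lemma phiM : {morph phi : s t / (s * t)%g}.
Proof. by move=> s t; apply/permP => k; rewrite permM !permE phi_funM. Qed.

Lemma oneline4 (s : 'S_4) : oneline s =
  [seq (val (s (inord i))).+1 | i <- [:: 0; 1; 2; 3]].
Proof.
rewrite /oneline -[[:: 0; _; _; _]]/(iota 0 4) -val_enum_ord -map_comp.
by apply: eq_map => i /=; rewrite inord_val.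
Qed.

Lemma oneline_phi (s : 'S_4) : oneline (phi s) =
  [seq (val (pairing_index (s (inord 0)) (s (inord i)))).+1
     | i <- [:: 1; 2; 3]].
Proof.
rewrite /oneline -[[:: 1; _; _]]/(map (fun i => i.+1) (iota 0 3)).
rewrite -val_enum_ord -!map_comp; apply: eq_map => i /=.
rewrite permE /phi_fun; congr (val (pairing_index (s _) (s _))).+1.
  by apply/val_inj; rewrite /= inordK.
by apply/val_inj; rewrite /= inordK // ltnS.
Qed.

Lemma oneline_inj (n : nat) : injective (@oneline n).
Proof.
move=> s t /eq_in_map st; apply/permP => i; apply/val_inj.
by have [] := st i (mem_enum 'I_n i).
Qed.

Lemma oneline1 (n : nat) : oneline (1%g : 'S_n) = iota 1 n.
Proof.
rewrite -[1 in RHS]/(1 + 0) iotaDl -val_enum_ord -map_comp.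
by apply: eq_map => i /=; rewrite perm1.
Qed.

Lemma phi_ker (s : 'S_4) : phi s = 1%g <->
  oneline s \in [:: [:: 1; 2; 3; 4]; [:: 2; 1; 4; 3];
                    [:: 4; 3; 2; 1]; [:: 3; 4; 1; 2]].
Proof.
suff -> : (oneline s \in [:: [:: 1; 2; 3; 4]; [:: 2; 1; 4; 3];
    [:: 4; 3; 2; 1]; [:: 3; 4; 1; 2]]) = (oneline (phi s) == iota 1 3).
  rewrite -oneline1; split=> [->//|/eqP]; exact: oneline_inj.
have sne i j : (i < 4) -> (j < 4) -> i != j ->
    (val (s (inord i)) != val (s (inord j))).
  move=> i4 j4 ij; rewrite (inj_eq val_inj) (inj_eq perm_inj).
  by rewrite -(inj_eq val_inj) /= !inordK.
have H01 := sne 0 1 isT isT isT; have H02 := sne 0 2 isT isT isT.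
have H03 := sne 0 3 isT isT isT; have H12 := sne 1 2 isT isT isT.
have H13 := sne 1 3 isT isT isT; have H23 := sne 2 3 isT isT isT.
rewrite oneline4 oneline_phi /pairing_index /=.
move: (s (inord 0)) (s (inord 1)) (s (inord 2)) (s (inord 3))
  H01 H02 H03 H12 H13 H23.
by do 4! case=> [[|[|[|[|?]]]] ?] //; rewrite /= !inordK.
Qed.

Lemma phi_val (s : 'S_4) :
  [/\ oneline s = [:: 2; 1; 3; 4] -> oneline (phi s) = [:: 1; 3; 2],
      oneline s = [:: 3; 2; 1; 4] -> oneline (phi s) = [:: 3; 2; 1],
      oneline s = [:: 4; 2; 3; 1] -> oneline (phi s) = [:: 2; 1; 3],
      oneline s = [:: 2; 4; 3; 1] -> oneline (phi s) = [:: 2; 3; 1]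
    & oneline s = [:: 3; 2; 4; 1] -> oneline (phi s) = [:: 3; 1; 2]].
Proof.
rewrite oneline4 oneline_phi /pairing_index /=.
by split; case=> -> -> -> ->; rewrite /= !inordK.
Qed.

Local Open Scope classical_set_scope.
Local Open Scope ring_scope.

Section SubMoebius.
Context {R : realType}.
Local Open Scope ereal_scope.

Definition sign_act (n : nat) (s : 'S_n) (v : 3.-tuple (\bar R)) :
  3.-tuple (\bar R) := [tuple ((-1) ^+ odd_perm s)%R%:E * tnth v k | k < 3].

Definition L4 : set (3.-tuple (\bar R)) :=
  [set v | exists a b c : R,
     (a + b + c = 0)%R /\ v = [tuple a%:E; b%:E; c%:E]].

Definition inf_vec1 : 3.-tuple (\bar R) := [tuple 0; +oo; -oo].
Definition inf_vec2 : 3.-tuple (\bar R) := [tuple -oo; 0; +oo].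
Definition inf_vec3 : 3.-tuple (\bar R) := [tuple +oo; -oo; 0].

Definition L4bar : set (3.-tuple (\bar R)) :=
  L4 `|` [set inf_vec1] `|` [set inf_vec2] `|` [set inf_vec3].

Definition admissible (X : eqType) (P : 4.-tuple X) : Prop :=
  forall x : X, (count_mem x P <= 2)%N.

Definition nondegenerate (X : eqType) (P : 4.-tuple X) : Prop := uniq P.

(* Maps defined on admissible tuples are total functions on 4-tuples of which
   only the values at admissible tuples matter. *)
Record sub_moebius (X : eqType) (M : 4.-tuple X -> 3.-tuple (\bar R)) : Prop :=
  SubMoebius {
    sub_moebius_range : forall P, admissible P -> L4bar (M P) ;
    sub_moebius_sign : forall P (s : 'S_4), admissible P ->
      M (perm_act s P) = sign_act s (perm_act (phi s) (M P)) ;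
    sub_moebius_fin : forall P, admissible P ->
      (L4 (M P) <-> nondegenerate P) ;
    sub_moebius_inf : forall x1 x3 x4, admissible [tuple x1; x1; x3; x4] ->
      M [tuple x1; x1; x3; x4] = inf_vec1
  }.

End SubMoebius.

Section Boundary.
Context {R : realType} {Y : metricType R}.
Implicit Types o : Y.

Definition gromov_product o (y y' : Y) : R :=
  2^-1 * (mdist y o + mdist y' o - mdist y y').

(* The two conditions below do not depend on the base point; quantifying over
   it makes the boundary an object without one. *)
Definition converges_to_infinity (x : nat -> Y) : Prop :=
  forall o, (fun ij : nat * nat => gromov_product o (x ij.1) (x ij.2))
    @ filter_prod \oo \oo --> +oo.

Definition equivalent_sequences (x y : nat -> Y) : Prop :=
  forall o, (fun i => gromov_product o (x i) (y i)) @ \oo --> +oo.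

Definition is_boundary_class (C : set (nat -> Y)) : Prop :=
  exists2 x, converges_to_infinity x &
    C = [set y | converges_to_infinity y /\ equivalent_sequences x y].

(* Isometries are onto, so that they act on the boundary by bijections. *)
Definition is_isometry (g : Y -> Y) : Prop :=
  bijective g /\ forall y y', mdist (g y) (g y') = mdist y y'.

End Boundary.

Definition gromov_hyperbolic (R : realType) (Y : metricType R) : Prop :=
  exists2 delta : R, 0 <= delta &
    forall o x y z : Y,
      Num.min (gromov_product o x z) (gromov_product o z y) - delta
        <= gromov_product o x y.

Record boundary (R : realType) (Y : metricType R) := Boundary {
  boundary_seqs :> set (nat -> Y) ;
  boundary_seqsP : is_boundary_class boundary_seqs
}.

HB.instance Definition _ (R : realType) (Y : metricType R) :=
  gen_eqMixin (boundary Y).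
HB.instance Definition _ (R : realType) (Y : metricType R) :=
  gen_choiceMixin (boundary Y).

Section Canonical.
Context {R : realType} {Y : metricType R}.
Implicit Types (o : Y) (alpha beta gamma delta : boundary Y).

Lemma isometry_boundary_class (g : Y -> Y) alpha : is_isometry g ->
  is_boundary_class [set g \o a | a in alpha].
Proof.
case=> -[h gK hK] gd.
have gp o (y y' : Y) : gromov_product o (g y) (g y') = gromov_product (h o) y y'.
  by rewrite /gromov_product -{1 2}(hK o) !gd.
have gc (a : nat -> Y) : converges_to_infinity (g \o a) <->
    converges_to_infinity a.
  split=> ca o; last by under eq_fun do rewrite gp; exact: ca.
  by have := ca (g o); under eq_fun do rewrite /= gp gK.
have ge (a b : nat -> Y) : equivalent_sequences (g \o a) (g \o b) <->
    equivalent_sequences a b.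
  split=> ca o; last by under eq_fun do rewrite gp; exact: ca.
  by have := ca (g o); under eq_fun do rewrite /= gp gK.
have [x cx ->] := boundary_seqsP alpha.
exists (g \o x); first exact/gc.
apply/seteqP; split=> [_ [a [ca xa] <-]|b [cb xb]].
  by split; [exact/gc|exact/ge].
have bE : b = g \o (h \o b) by apply/funext => i /=; rewrite hK.
exists (h \o b); last by rewrite -bE.
by split; [apply/gc; rewrite -bE|apply/ge; rewrite -bE].
Qed.

Definition boundary_map (g : Y -> Y) (hg : is_isometry g) alpha : boundary Y :=
  Boundary (isometry_boundary_class alpha hg).

Definition cross_difference o (a b c d : Y) : R :=
  gromov_product o a d + gromov_product o b c
  - gromov_product o a c - gromov_product o b d.

Local Open Scope ereal_scope.

(* The last condition makes equal entries use the same sequence. *)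
Definition cd o alpha beta gamma delta : \bar R :=
  ereal_sup [set t | exists a b c d : nat -> Y,
    [/\ [/\ boundary_seqs alpha a, boundary_seqs beta b,
            boundary_seqs gamma c & boundary_seqs delta d],
        forall k l : 'I_4,
          tnth [tuple alpha; beta; gamma; delta] k
            = tnth [tuple alpha; beta; gamma; delta] l ->
          tnth [tuple a; b; c; d] k = tnth [tuple a; b; c; d] l
      & t = limn_einf (fun i => (cross_difference o (a i) (b i) (c i) (d i))%:E)]].

Definition M_tilde o (P : 4.-tuple (boundary Y)) : 3.-tuple (\bar R) :=
  let x1 := [tnth P 0] in let x2 := [tnth P 1] in
  let x3 := [tnth P 2] in let x4 := [tnth P 3] in
  if (x1 == x2) || (x3 == x4) then inf_vec1
  else if (x1 == x3) || (x2 == x4) then inf_vec2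
  else if (x1 == x4) || (x2 == x3) then inf_vec3
  else let u := cd o x1 x2 x3 x4 in
       let v := cd o x1 x3 x4 x2 in
       [tuple u; v; - u - v].

(* For degenerate P all summands are the same infinite vector, so the
   componentwise average in the extended reals never meets oo - oo. *)
Definition M_avg o (P : 4.-tuple (boundary Y)) : 3.-tuple (\bar R) :=
  [tuple (#|{: 'S_4}|%:R^-1)%R%:E *
     \sum_(rho : 'S_4)
        tnth (sign_act rho
                (perm_act (phi rho^-1%g) (M_tilde o (perm_act rho P)))) k
   | k < 3].

End Canonical.

(* Main.v *)
Require Import Defs.
From mathcomp Require Import all_boot all_order all_fingroup all_algebra.
From mathcomp Require Import all_classical all_reals all_analysis.
From mathcomp Require Import lra.

Set Implicit Arguments.
Unset Strict Implicit.
Unset Printing Implicit Defensive.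

Import Order.TTheory GRing.Theory Num.Theory.

(** Three independent facts give the theorem.

    Finiteness. In a hyperbolic space the Gromov products of two sequences
    that represent distinct boundary points are bounded from some index on, by
    a constant that depends only on the two points
    ([gromov_product_bounded]). A cross-difference is a signed sum of four such
    products, so [cd] is finite at four distinct points ([cd_fin_num]) and
    [M_tilde] takes values in [L4] at nondegenerate tuples. The space [L4] is
    stable under permutations, signs and averages.

    Symmetry. Averaging makes the map equivariant: replacing [P] by [s P]
    amounts to reindexing the sum over [S_4] by right multiplication by [s]
    ([M_avg_perm_act]). At a degenerate tuple the average changes nothing. The
    value of [M_tilde] there depends only on the splitting of the four indices
    into pairs in which the coincidence occurs, this splitting is moved by
    [phi], and the orientation of the infinite vector is moved by the sign
    ([inf_vec_phi]). So all summands agree ([summand_degenerate]), and the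
    average is an infinite vector of the right kind.

    Invariance. The distances to the base point cancel in a cross-difference,
    which is thus a function of the mutual distances of the four points
    ([cross_differenceE]). Hence [cd] is the same for all base points, and an
    isometry, which carries the sequences of a boundary point onto those of
    its image, does not change it. *)

(** * Gromov products *)

Section GromovProduct.
Local Open Scope classical_set_scope.
Local Open Scope ring_scope.
Context {R : realType} {Y : metricType R}.
Implicit Types (o a b c d : Y).

Lemma gromov_product_ge0 o a b : 0 <= gromov_product o a b.
Proof.
rewrite /gromov_product; have := metric_triangle a o b.
rewrite (metric_sym o b); lra.
Qed.

Lemma gromov_product_sym o a b : gromov_product o a b = gromov_product o b a.
Proof. by rewrite /gromov_product (metric_sym b a) [mdist a o + _]addrC. Qed.

Lemma gromov_product_change o o' a b :
  gromov_product o a b - mdist o o' <= gromov_product o' a b.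
Proof.
rewrite /gromov_product.
have := metric_triangle a o' o; have := metric_triangle b o' o.
rewrite (metric_sym o' o); lra.
Qed.

(** The distances to [o] cancel: this is why [cd] needs no base point. *)
Lemma cross_differenceE o a b c d : cross_difference o a b c d =
  2^-1 * (mdist a c + mdist b d - mdist a d - mdist b c).
Proof. rewrite /cross_difference /gromov_product; lra. Qed.

End GromovProduct.

(** * Sequences tending to distinct boundary points *)

Section HyperbolicBoundary.
Local Open Scope classical_set_scope.
Local Open Scope ring_scope.
Context {R : realType} {Y : metricType R}.
Context (hY : gromov_hyperbolic Y).
Implicit Types (o : Y) (a b c d : nat -> Y) (alpha beta : boundary Y).

Lemma converges_to_infinityP a o : converges_to_infinity a ->
  forall A : R, exists N : nat, forall i j : nat, (N <= i)%N -> (N <= j)%N ->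
    A <= gromov_product o (a i) (a j).
Proof.
move=> /(_ o)/cvgryPge ca A.
have [[P Q] /= [[n _ nP] [m _ mQ]] PQ] := ca A.
exists (maxn n m) => i j; rewrite !geq_max => /andP[ni _] /andP[_ mj].
by apply: (PQ (i, j)); split; [exact: nP|exact: mQ].
Qed.

Lemma equivalent_sequences_sym a b :
  equivalent_sequences a b -> equivalent_sequences b a.
Proof.
by move=> ab o; under eq_fun do rewrite gromov_product_sym; exact: ab.
Qed.

Lemma equivalent_sequences_trans a b c : equivalent_sequences a b ->
  equivalent_sequences b c -> equivalent_sequences a c.
Proof.
have [delta _ hdelta] := hY; move=> ab bc o; apply/cvgryPge => A.
near=> i; apply: le_trans (hdelta o (a i) (c i) (b i)).
rewrite lerBrDr le_min; apply/andP; split; near: i.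
- by have /cvgryPge := ab o; exact.
- by have /cvgryPge := bc o; exact.
Unshelve. all: by end_near. Qed.

(** Along a sequence converging to infinity, all late terms are close to each
    other as seen from [o]; hence a single late index at which [a] and [d] are
    close forces them to be close at all late indices, and for another base
    point as well. *)
Lemma equivalent_of_frequently o a d :
  converges_to_infinity a -> converges_to_infinity d ->
  (forall (A : R) (N : nat),
     exists2 i, (N <= i)%N & A <= gromov_product o (a i) (d i)) ->
  equivalent_sequences a d.
Proof.
have [delta delta0 hdelta] := hY; move=> ca cd fad o'; apply/cvgryPge => A.
(* Two uses of hyperbolicity cost 2 delta, the change of base point |oo'|. *)
pose B := A + mdist o o' + 2 * delta.
have [N aN] := converges_to_infinityP o ca B.
have [N' dN] := converges_to_infinityP o cd B.
exists (maxn N N') => // j /=; rewrite geq_max => /andP[Nj N'j].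
have [i] := fad B (maxn N N'); rewrite geq_max => /andP[Ni N'i] Bi.
have h1 := hdelta o (a i) (d j) (d i).
have h2 := hdelta o (a j) (d j) (a i).
have {}h1 : B - delta <= gromov_product o (a i) (d j).
  by apply: le_trans h1; rewrite lerD2r le_min Bi dN.
have {}h2 : B - delta - delta <= gromov_product o (a j) (d j).
  apply: le_trans h2; rewrite lerD2r le_min h1 andbT.
  by apply: le_trans (aN _ _ Nj Ni); rewrite gerBl.
have := gromov_product_change o o' (a j) (d j).
by move: h2; rewrite /B; lra.
Qed.

Lemma boundary_converges alpha a :
  boundary_seqs alpha a -> converges_to_infinity a.
Proof. by have [x _ ->] := boundary_seqsP alpha; case. Qed.

Lemma boundary_equivalent alpha a b :
  boundary_seqs alpha a -> boundary_seqs alpha b -> equivalent_sequences a b.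
Proof.
have [x _ ->] := boundary_seqsP alpha => -[_ xa] [_ xb].
exact: equivalent_sequences_trans (equivalent_sequences_sym xa) xb.
Qed.

Lemma boundary_inj alpha beta :
  boundary_seqs alpha = boundary_seqs beta -> alpha = beta.
Proof.
case: alpha beta => [A hA] [B hB] /= AB; case: B / AB hB => hB.
by rewrite (Prop_irrelevance hA hB).
Qed.

Lemma boundary_nonempty alpha : exists a, boundary_seqs alpha a.
Proof.
have [x cx ->] := boundary_seqsP alpha; exists x; split=> // o.
apply/cvgryPge => A; have [N hN] := converges_to_infinityP o cx A.
by exists N => // i /= Ni; exact: hN.
Qed.

(** Distinct boundary points have no equivalent representatives: by
    transitivity the two classes would coincide. *)
Lemma boundary_eq alpha beta a b :
  boundary_seqs alpha a -> boundary_seqs beta b ->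
  equivalent_sequences a b -> alpha = beta.
Proof.
move=> aa bb ab; apply: boundary_inj.
wlog suff : alpha beta a b aa bb ab / boundary_seqs alpha `<=` beta.
  move=> H; apply/seteqP; split; first exact: (H alpha beta a b).
  exact: (H beta alpha b a bb aa (equivalent_sequences_sym ab)).
move=> c ac; have [x _ xE] := boundary_seqsP beta.
move: bb; rewrite xE => -[_ xb]; split; first exact: boundary_converges ac.
apply: equivalent_sequences_trans xb _.
apply: equivalent_sequences_trans (equivalent_sequences_sym ab) _.
exact: boundary_equivalent aa ac.
Qed.

(** The bound does not depend on the representatives: changing them affects
    late products by at most twice the hyperbolicity constant. *)
Lemma gromov_product_bounded o alpha beta : alpha <> beta ->
  exists B : R, forall a b, boundary_seqs alpha a -> boundary_seqs beta b ->
    \forall i \near \oo, gromov_product o (a i) (b i) <= B.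
Proof.
move=> ab; have [delta delta0 hdelta] := hY.
have [a0 aa0] := boundary_nonempty alpha.
have [b0 bb0] := boundary_nonempty beta.
have [C [N hC]] : exists C : R, exists N : nat, forall i, (N <= i)%N ->
    gromov_product o (a0 i) (b0 i) < C.
  apply: contrapT => nC; apply: ab; apply: (boundary_eq aa0 bb0).
  apply: (equivalent_of_frequently (o := o)).
  - exact: boundary_converges aa0.
  - exact: boundary_converges bb0.
  move=> A n; apply: contrapT => nA; apply: nC; exists A, n => i ni.
  by rewrite ltNge; apply/negP => Ai; apply: nA; exists i.
(* If (a_i|b_i) exceeded C + 2 delta, then (a0_i|b0_i) would exceed C, since
   (a0_i|a_i) and (b_i|b0_i) are eventually large. *)
exists (C + 2 * delta) => a b aa bb.
have /(_ o)/cvgryPge/(_ (C + delta)) eaa := boundary_equivalent aa0 aa.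
have /(_ o)/cvgryPge/(_ (C + 2 * delta)) ebb := boundary_equivalent bb bb0.
near=> i; rewrite leNgt; apply/negP => lt_i.
have := hdelta o (a i) (b0 i) (b i); have := hdelta o (a0 i) (b0 i) (a i).
have hCi : gromov_product o (a0 i) (b0 i) < C.
  by apply: hC; near: i; exact: nbhs_infty_ge.
have ai : C + delta <= gromov_product o (a0 i) (a i) by near: i.
have bi : C + 2 * delta <= gromov_product o (b i) (b0 i) by near: i.
move=> h1 h2.
have {}h2 : C + 2 * delta - delta <= gromov_product o (a i) (b0 i).
  by apply: le_trans h2; rewrite lerD2r le_min bi (ltW lt_i).
have : C + delta - delta <= gromov_product o (a0 i) (b0 i).
  apply: le_trans h1; rewrite lerD2r le_min ai /=; lra.
lra.
Unshelve. all: by end_near. Qed.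

Lemma limn_einf_bounds (u : nat -> R) (A B : R) :
  (\forall i \near \oo, A <= u i <= B) ->
  (A%:E <= limn_einf (EFin \o u) <= B%:E)%E.
Proof.
move=> uAB; rewrite [limn_einf _]limf_einfE; apply/andP; split.
  apply: le_trans (ereal_sup_ubound _); last first.
    by exists [set i | A <= u i <= B] => //; exact: uAB.
  by apply: le_ereal_inf_tmp => _ [i /andP[Ai _] <-]; rewrite lee_fin.
apply: ge_ereal_sup => _ [V VF <-].
have [i [Vi /andP[_ iB]]] : (V `&` [set i | A <= u i <= B]) !=set0.
  exact: (filter_ex (filterI VF uAB)).
by apply: ge_ereal_inf; exists (u i)%:E; [exists i|rewrite lee_fin].
Qed.

(** All four Gromov products of a cross-difference stay bounded along
    sequences tending to distinct boundary points. *)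
Lemma cd_fin_num o alpha beta gamma delta :
  uniq [:: alpha; beta; gamma; delta] ->
  cd o alpha beta gamma delta \is a fin_num.
Proof.
move=> distinct.
have inj4 : injective (tnth [tuple alpha; beta; gamma; delta]).
  exact/tuple_uniqP.
have apart k l : k != l -> tnth [tuple alpha; beta; gamma; delta] k <>
    tnth [tuple alpha; beta; gamma; delta] l by move=> /eqP kl /inj4.
have ac : alpha <> gamma := apart 0 2 isT.
have ad : alpha <> delta := apart 0 3 isT.
have bc : beta <> gamma := apart 1 2 isT.
have bd : beta <> delta := apart 1 3 isT.
have [A hA] := gromov_product_bounded o ad.
have [B hB] := gromov_product_bounded o bc.
have [C hC] := gromov_product_bounded o ac.
have [D hD] := gromov_product_bounded o bd.
have cd_bounds (a b c d : nat -> Y) :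
    boundary_seqs alpha a -> boundary_seqs beta b ->
    boundary_seqs gamma c -> boundary_seqs delta d ->
    ((- C - D)%:E <= limn_einf (fun i =>
      (cross_difference o (a i) (b i) (c i) (d i))%:E) <= (A + B)%:E)%E.
  move=> aa bb cc dd; apply: limn_einf_bounds; near=> i.
  have h1 : gromov_product o (a i) (d i) <= A by near: i; exact: hA.
  have h2 : gromov_product o (b i) (c i) <= B by near: i; exact: hB.
  have h3 : gromov_product o (a i) (c i) <= C by near: i; exact: hC.
  have h4 : gromov_product o (b i) (d i) <= D by near: i; exact: hD.
  have := gromov_product_ge0 o (a i) (d i).
  have := gromov_product_ge0 o (b i) (c i).
  have := gromov_product_ge0 o (a i) (c i).
  have := gromov_product_ge0 o (b i) (d i).
  by rewrite /cross_difference; lra.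
rewrite fin_numElt; apply/andP; split; last first.
  apply: le_lt_trans (ltry (A + B)); apply: ge_ereal_sup.
  move=> _ [a [b [c [d [[aa bb cc dd] _ ->]]]]].
  by have /andP[] := cd_bounds _ _ _ _ aa bb cc dd.
have [a aa] := boundary_nonempty alpha.
have [b bb] := boundary_nonempty beta.
have [c cc] := boundary_nonempty gamma.
have [d dd] := boundary_nonempty delta.
have /andP[+ _] := cd_bounds _ _ _ _ aa bb cc dd.
move=> /(lt_le_trans (ltNyr _))/lt_le_trans; apply; apply: ereal_sup_ubound.
by exists a, b, c, d; split=> // k l /inj4 ->.
Unshelve. all: by end_near. Qed.

End HyperbolicBoundary.

(** * Permutations and coincidences of 4-tuples *)

Section TupleAction.
Local Open Scope group_scope.

Lemma perm_actM (n : nat) (T : Type) (s t : 'S_n) (x : n.-tuple T) :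
  perm_act s (perm_act t x) = perm_act (s * t) x.
Proof. by apply/eq_from_tnth => i; rewrite !tnth_mktuple permM. Qed.

Lemma perm_act_map (n : nat) (T U : Type) (f : T -> U) (s : 'S_n)
  (x : n.-tuple T) : perm_act s (map_tuple f x) = map_tuple f (perm_act s x).
Proof. by apply/eq_from_tnth => i; rewrite !(tnth_mktuple, tnth_map). Qed.

Lemma phi1 : phi 1 = 1.
Proof. by apply: (mulIg (phi 1)); rewrite -phiM !mul1g. Qed.

End TupleAction.

Section Coincidences.
Context {X : eqType}.
Implicit Types P : 4.-tuple X.

Lemma admissible_perm_act (s : 'S_4) P :
  admissible P -> admissible (perm_act s P).
Proof.
move=> aP x; have /seq.permP -> : perm_eq (perm_act s P) P; last exact: aP.
by apply/tuple_permP; exists s.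
Qed.

Lemma nondegenerate_perm_act (s : 'S_4) P :
  Defs.nondegenerate P -> Defs.nondegenerate (perm_act s P).
Proof.
move=> /tuple_uniqP iP; apply/tuple_uniqP => i j.
by rewrite !tnth_mktuple => /iP/perm_inj.
Qed.

Lemma degenerate_coincidence P : ~ Defs.nondegenerate P ->
  exists i j : 'I_4, i != j /\ tnth P i = tnth P j.
Proof.
move=> nP; apply: contrapT => nex; apply: nP; apply/tuple_uniqP => i j ij.
by apply/eqP; apply: contrapT => /negP nij; apply: nex; exists i, j.
Qed.

(** The case distinction in the definition of [M_tilde], with arbitrary entries
    and values: [v] lists the values for coincidences in the three splittings,
    [w] is the value when all entries are distinct. *)
Definition by_coincidence (T : Type) P (v : 3.-tuple T) (w : T) : T :=
  let x1 := [tnth P 0] in let x2 := [tnth P 1] in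
  let x3 := [tnth P 2] in let x4 := [tnth P 3] in
  if (x1 == x2) || (x3 == x4) then [tnth v 0]
  else if (x1 == x3) || (x2 == x4) then [tnth v 1]
  else if (x1 == x4) || (x2 == x3) then [tnth v 2]
  else w.

Lemma admissible_triple P (i j k : 'I_4) : admissible P ->
  i != j -> i != k -> j != k -> tnth P i = tnth P j -> tnth P i = tnth P k ->
  False.
Proof.
move=> /(_ (tnth P i)) + ij ik jk Pij Pik; rewrite leqNgt => /negP; apply.
rewrite -sum1_count big_tuple sum1_card.
have c3 : #|[set i; j; k]| = 3.
  by rewrite -finset.setUA !cardsU1 cards1 !inE negb_or ij ik jk.
apply: (@leq_trans #|[set i; j; k]|); first by rewrite c3.
apply/subset_leq_card/fintype.subsetP => l; rewrite !inE.
by move=> /orP[/orP[]|] /eqP ->; apply/eqP.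
Qed.

Lemma pairing_indexC (i j : 'I_4) : pairing_index i j = pairing_index j i.
Proof. by rewrite /pairing_index orbC addnC. Qed.

(** Two pairs from different splittings share an index, and would therefore
    force three equal entries. *)
Lemma coincidence_pairing P (i j i' j' : 'I_4) : admissible P ->
  i != j -> tnth P i = tnth P j -> i' != j' -> tnth P i' = tnth P j' ->
  pairing_index i j = pairing_index i' j'.
Proof.
move=> aP ij Pij ij' Pij'; have share a b c : a != b -> tnth P a = tnth P b ->
    a != c -> tnth P a = tnth P c -> b = c.
  move=> ab Pab ac Pac; apply/eqP; apply: contrapT => /negP bc.
  exact: (admissible_triple aP ab ac bc Pab Pac).
have [E|ii'] := eqVneq i i'.
  by rewrite -E in ij' Pij' *; rewrite (share i j j').
have [E|ij''] := eqVneq i j'.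
  rewrite -E eq_sym in ij' Pij' *.
  by rewrite pairing_indexC (share i j i').
have [E|ji'] := eqVneq j i'.
  rewrite -E in ij' Pij' *.
  by rewrite pairing_indexC (share j i j') // eq_sym.
have [E|jj'] := eqVneq j j'.
  by rewrite -E eq_sym in ij' Pij' *; rewrite (share j i i') // eq_sym.
(* Disjoint pairs form a splitting; the finitely many cases are checked. *)
move: ij ij' ii' ij'' ji' jj' {Pij Pij' share}.
by case: i j i' j' => [[|[|[|[|?]]]] ?] [[|[|[|[|?]]]] ?]
  [[|[|[|[|?]]]] ?] [[|[|[|[|?]]]] ?].
Qed.

(** The order of the tests is immaterial: by [coincidence_pairing] whichever
    test succeeds first belongs to the splitting containing [i] and [j]. *)
Lemma by_coincidence_degenerate (T : Type) P (v : 3.-tuple T) (w : T)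
    (i j : 'I_4) : admissible P -> i != j -> tnth P i = tnth P j ->
  by_coincidence P v w = tnth v (pairing_index i j).
Proof.
move=> aP ij Pij.
have pE (k l : 'I_4) (m : 'I_3) : pairing_index k l = m -> k != l ->
    tnth P k == tnth P l -> tnth v m = tnth v (pairing_index i j).
  by move=> <- kl /eqP Pkl; rewrite (coincidence_pairing aP ij Pij kl Pkl).
rewrite /by_coincidence.
case: ifPn => [/orP[] e|/norP[n01 n23]].
- by apply: (pE _ _ _ _ _ e) => //; apply/val_inj; rewrite /= inordK.
- by apply: (pE _ _ _ _ _ e) => //; apply/val_inj; rewrite /= inordK.
case: ifPn => [/orP[] e|/norP[n02 n13]].
- by apply: (pE _ _ _ _ _ e) => //; apply/val_inj; rewrite /= inordK.
- by apply: (pE _ _ _ _ _ e) => //; apply/val_inj; rewrite /= inordK.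
case: ifPn => [/orP[] e|/norP[n03 n12]].
- by apply: (pE _ _ _ _ _ e) => //; apply/val_inj; rewrite /= inordK.
- by apply: (pE _ _ _ _ _ e) => //; apply/val_inj; rewrite /= inordK.
have uP : uniq P.
  suff -> : P = [tuple [tnth P 0]; [tnth P 1]; [tnth P 2]; [tnth P 3]].
    by rewrite !cons_uniq !inE !negb_or n01 n02 n03 n12 n13 n23.
  apply/eq_from_tnth => -[[|[|[|[|//]]]] ?];
  by rewrite [RHS](tnth_nth [tnth P 0]) /=; congr tnth; apply/val_inj.
by have /tuple_uniqP/(_ i j Pij) E := uP; rewrite E eqxx in ij.
Qed.

Lemma by_coincidence_nondegenerate (T : Type) P (v : 3.-tuple T) (w : T) :
  Defs.nondegenerate P -> by_coincidence P v w = w.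
Proof.
move=> /tuple_uniqP iP; have neq i j : i != j -> (tnth P i == tnth P j) = false.
  by move=> ij; rewrite (inj_eq iP); exact/negbTE.
by rewrite /by_coincidence !neq.
Qed.

End Coincidences.

(** * Infinite vectors and averages *)

Section InfiniteVectors.
Local Open Scope group_scope.
Local Open Scope ereal_scope.
Context {R : realType}.
Implicit Types (s t : 'S_4) (k l : 'I_3).

(** The infinite vector of tuples with a coincidence in the splitting [k]. *)
Definition inf_vec k : 3.-tuple (\bar R) :=
  tnth [tuple inf_vec1; inf_vec2; inf_vec3] k.

Lemma sign_mulE (b : bool) (x : \bar R) :
  ((-1) ^+ b)%R%:E * x = if b then - x else x.
Proof. by case: b; rewrite ?expr1 ?expr0 ?mulN1e ?mul1e. Qed.

(** A transposition in [S_4] acts on the three splittings as a transposition,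
    and a transposition of two coordinates reverses the cyclic order in which
    0, +oo, -oo are read. *)
Lemma inf_vec_tperm (x y : 'I_4) k l : x != y ->
  tnth (inf_vec (phi (tperm x y) k)) (phi (tperm x y) l) =
  - tnth (inf_vec k) l.
Proof.
rewrite !permE /phi_fun !permE /pairing_index /inf_vec !(tnth_nth 0) /=.
rewrite !(tnth_nth inf_vec1) /=.
case: x y => [[|[|[|[|?]]]] ?] [[|[|[|[|?]]]] ?] //=;
case: k => [[|[|[|?]]] ?] //=; case: l => [[|[|[|?]]] ?] //= _;
by rewrite !inordK //= ?oppr0.
Qed.

(** The symmetry that [M_tilde] has at degenerate tuples. It is multiplicative
    in [s], so the case of transpositions suffices. *)
Lemma inf_vec_phi s k l :
  ((-1) ^+ odd_perm s)%R%:E * tnth (inf_vec (phi s k)) (phi s l) =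
  tnth (inf_vec k) l.
Proof.
have [ts ->] := prod_tpermP s; elim: ts k l => [|t ts IH] k l /=.
  by rewrite big_nil phi1 odd_perm1 !perm1 mul1e.
case/andP=> t12 tsd; rewrite big_cons odd_mul_tperm t12 phiM !permM.
rewrite signr_addb EFinM -muleA IH // inf_vec_tperm //.
by rewrite sign_mulE oppeK.
Qed.

Lemma inf_vec_not_L4 k : ~ L4 (inf_vec k).
Proof.
case=> a [b [c [_ E]]].
have := congr1 (fun v : 3.-tuple (\bar R) => [tnth v 0]) E.
have := congr1 (fun v : 3.-tuple (\bar R) => [tnth v 1]) E.
rewrite /inf_vec !(tnth_nth 0) !(tnth_nth inf_vec1).
by case: k {E} => [[|[|[|?]]] ?].
Qed.

Lemma inf_vec_L4bar k : L4bar (inf_vec k).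
Proof.
rewrite /inf_vec (tnth_nth inf_vec1).
by case: k => [[|[|[|//]]] ?] /=; [left; left; right|left; right|right].
Qed.

End InfiniteVectors.

Section Averages.
Local Open Scope group_scope.
Local Open Scope ereal_scope.
Context {R : realType}.

Lemma L4P (v : 3.-tuple (\bar R)) :
  L4 v <-> exists2 f : 'I_3 -> R, (\sum_k f k = 0)%R &
             forall k, tnth v k = (f k)%:E.
Proof.
split=> [[a [b [c [abc ->]]]]|[f f0 vf]].
  exists (tnth [tuple a; b; c]).
    by rewrite !big_ord_recr big_ord0 /= !(tnth_nth 0%R) /= add0r.
  by case=> [[|[|[|//]]] ?]; rewrite (tnth_nth 0) (tnth_nth 0%R).
exists (f 0%R), (f 1%R), (f 2%R); split.
  rewrite -f0 !big_ord_recr big_ord0 /= add0r.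
  by congr (f _ + f _ + f _)%R; apply/val_inj.
apply/eq_from_tnth => k; rewrite vf (tnth_nth 0).
by case: k => [[|[|[|//]]] ?] /=; congr (f _)%:E; apply/val_inj.
Qed.

Lemma mean_const (T : finType) (x : \bar R) : (0 < #|T|)%N ->
  (#|T|%:R^-1)%R%:E * \sum_(i : T) x = x.
Proof.
move=> T0; have -> : \sum_(i : T) x = #|T|%:R%:E * x.
  by rewrite big_const -Monoid.iteropE mule_natl.
rewrite muleA -EFinM mulVf ?mul1e //.
by rewrite pnatr_eq0 -lt0n.
Qed.

End Averages.

(** * The averaged map *)

Section CanonicalMap.
Local Open Scope group_scope.
Local Open Scope ereal_scope.
Context {R : realType} {Y : metricType R}.
Implicit Types (o : Y) (P : 4.-tuple (boundary Y)) (rho s : 'S_4).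

Lemma M_tildeE o P : M_tilde o P =
  by_coincidence P [tuple inf_vec1; inf_vec2; inf_vec3]
    [tuple cd o [tnth P 0] [tnth P 1] [tnth P 2] [tnth P 3];
           cd o [tnth P 0] [tnth P 2] [tnth P 3] [tnth P 1];
           - cd o [tnth P 0] [tnth P 1] [tnth P 2] [tnth P 3]
           - cd o [tnth P 0] [tnth P 2] [tnth P 3] [tnth P 1]].
Proof. by rewrite /by_coincidence !(tnth_nth inf_vec1). Qed.

Lemma M_tilde_degenerate o P (i j : 'I_4) :
  admissible P -> i != j -> tnth P i = tnth P j ->
  M_tilde o P = inf_vec (pairing_index i j).
Proof.
by move=> aP ij Pij; rewrite M_tildeE (by_coincidence_degenerate _ _ aP ij).
Qed.

Lemma M_tilde_nondegenerate o P : gromov_hyperbolic Y ->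
  Defs.nondegenerate P -> L4 (M_tilde o P).
Proof.
move=> hY ndP; rewrite M_tildeE by_coincidence_nondegenerate //.
have /tuple_uniqP iP := ndP.
have finu : cd o [tnth P 0] [tnth P 1] [tnth P 2] [tnth P 3] \is a fin_num.
  by apply: cd_fin_num => //; rewrite !cons_uniq !inE !(inj_eq iP).
have finv : cd o [tnth P 0] [tnth P 2] [tnth P 3] [tnth P 1] \is a fin_num.
  by apply: cd_fin_num => //; rewrite !cons_uniq !inE !(inj_eq iP).
move: finu finv; case: (cd o _ _ _ _) => [u| |] // _.
case: (cd o _ _ _ _) => [v| |] // _.
by exists u, v, (- u - v)%R; split; first lra.
Qed.

(** The summand of [M_avg]; the sign and the permutation are those for which
    it would be independent of [rho] if [M_tilde] itself had the symmetry of a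
    sub-Moebius structure. *)
Definition summand o P rho (k : 'I_3) : \bar R :=
  ((-1) ^+ odd_perm rho)%R%:E *
  tnth (M_tilde o (perm_act rho P)) (phi rho^-1 k).

Lemma M_avgE o P k : tnth (M_avg o P) k =
  (#|{: 'S_4}|%:R^-1)%R%:E * \sum_rho summand o P rho k.
Proof.
rewrite tnth_mktuple; congr (_ * _); apply: eq_bigr => rho _.
by rewrite /sign_act !tnth_mktuple.
Qed.

Lemma card_S4_gt0 : (0 < #|{: 'S_4}|)%N.
Proof. by apply/card_gt0P; exists 1%g. Qed.

(** The coincidence of [P] at [i], [j] sits in [rho P] at the preimages of [i]
    and [j] under [rho], so the sign and the permutation in [summand] undo the
    change from [P] to [rho P]. *)
Lemma summand_degenerate o P (i j : 'I_4) rho k :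
  admissible P -> i != j -> tnth P i = tnth P j ->
  summand o P rho k = tnth (inf_vec (pairing_index i j)) k.
Proof.
move=> aP ij Pij; rewrite /summand.
rewrite (@M_tilde_degenerate _ _ (rho^-1%g i) (rho^-1%g j)).
- rewrite -pairing_index_act // -[phi_fun _ _](permE (@phi_fun_inj _)).
  by rewrite -/(phi _) -odd_permV inf_vec_phi.
- exact: admissible_perm_act.
- by rewrite (inj_eq perm_inj).
- by rewrite !tnth_mktuple !permKV.
Qed.

Lemma M_avg_degenerate o P (i j : 'I_4) :
  admissible P -> i != j -> tnth P i = tnth P j ->
  M_avg o P = inf_vec (pairing_index i j).
Proof.
move=> aP ij Pij; apply/eq_from_tnth => k; rewrite M_avgE.
under eq_bigr do rewrite (summand_degenerate _ _ _ aP ij Pij).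
exact: (mean_const _ card_S4_gt0).
Qed.

Lemma summand_finite o P : gromov_hyperbolic Y -> Defs.nondegenerate P ->
  exists2 F : 'S_4 -> 'I_3 -> R, (forall rho, \sum_k F rho k = 0)%R &
    forall rho k, summand o P rho k = (F rho k)%:E.
Proof.
move=> hY ndP.
have /choice[f fE] rho : exists f : 'I_3 -> R, (\sum_k f k = 0)%R /\
    forall k, tnth (M_tilde o (perm_act rho P)) k = (f k)%:E.
  have /L4P[f f0 fE] :=
    M_tilde_nondegenerate o hY (nondegenerate_perm_act rho ndP).
  by exists f.
exists (fun rho k => (-1) ^+ odd_perm rho * f rho (phi rho^-1%g k))%R.
  move=> rho; rewrite -mulr_sumr; have := (fE rho).1.
  by rewrite (reindex_inj (@perm_inj _ (phi rho^-1%g))) /= => ->; rewrite mulr0.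
by move=> rho k; rewrite /summand (fE rho).2.
Qed.

Lemma M_avg_nondegenerate o P : gromov_hyperbolic Y ->
  Defs.nondegenerate P -> L4 (M_avg o P).
Proof.
move=> hY /(summand_finite o hY)[F F0 FE]; apply/L4P.
exists (fun k => #|{: 'S_4}|%:R^-1 * \sum_rho F rho k)%R => [|k].
  by rewrite -mulr_sumr exchange_big /= big1 ?mulr0.
by rewrite M_avgE (eq_bigr _ (fun rho _ => FE rho k)) sumEFin EFinM.
Qed.

(** The sum over [S_4] never meets +oo - oo, so that a sign distributes over
    it. *)
Lemma summand_adde_def o P k : gromov_hyperbolic Y -> admissible P ->
  {in xpredT &, forall rho s, summand o P rho k +? summand o P s k}.
Proof.
move=> hY aP rho s _ _.
have [ndP|/degenerate_coincidence[i [j [ij Pij]]]] :=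
    pselect (Defs.nondegenerate P).
  by have [F _ FE] := summand_finite o hY ndP; rewrite !FE.
rewrite !(summand_degenerate _ _ _ aP ij Pij).
by case: (tnth _ _).
Qed.

(** Since [rho (s P) = (rho * s) P], the sum for [s P] is the sum for [P]
    reindexed by right multiplication by [s]; what remains of the sign and of
    [phi] after the substitution does not depend on the summation index. *)
Lemma M_avg_perm_act o P s : gromov_hyperbolic Y -> admissible P ->
  M_avg o (perm_act s P) = sign_act s (perm_act (phi s) (M_avg o P)).
Proof.
move=> hY aP; apply/eq_from_tnth => k.
have rhsE : tnth (sign_act s (perm_act (phi s) (M_avg o P))) k =
    ((-1) ^+ odd_perm s)%R%:E *
    ((#|{: 'S_4}|%:R^-1)%R%:E * \sum_rho summand o P rho (phi s k)).
  rewrite [LHS]tnth_mktuple; congr (_ * _); rewrite [LHS]tnth_mktuple.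
  exact: M_avgE.
have distr : ((-1) ^+ odd_perm s)%R%:E * \sum_rho summand o P rho (phi s k) =
    \sum_rho ((-1) ^+ odd_perm s)%R%:E * summand o P rho (phi s k).
  apply: fin_num_sume_distrr; first by [].
  exact: summand_adde_def.
rewrite rhsE M_avgE [RHS]muleCA distr.
congr (_ * _); rewrite (reindex_inj (mulIg s^-1%g)) /=; apply: eq_bigr => rho _.
rewrite /summand perm_actM mulgKV invMg invgK phiM permM.
by rewrite odd_permM odd_permV signr_addb EFinM muleAC muleC.
Qed.

Lemma cd_basepoint o o' : cd o = cd o' :> (_ -> _).
Proof.
apply/funext => alpha; apply/funext => beta.
apply/funext => gamma; apply/funext => delta.
congr ereal_sup; apply/funext => t; apply/propext.
split=> -[a [b [c [d [abcd eqs ->]]]]]; exists a, b, c, d; split=> //;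
  by congr limn_einf; apply/funext => i; rewrite !cross_differenceE.
Qed.

Lemma M_avg_basepoint o o' P : M_avg o P = M_avg o' P.
Proof. by rewrite /M_avg /M_tilde (cd_basepoint o o'). Qed.

Context (g : Y -> Y) (hg : is_isometry g).

Lemma boundary_map_inj : injective (boundary_map hg).
Proof.
have [[h gK hK] _] := hg.
have sub (alpha beta : boundary Y) :
    boundary_map hg alpha = boundary_map hg beta ->
    (boundary_seqs alpha `<=` boundary_seqs beta)%classic.
  move=> /(congr1 (@boundary_seqs _ _))/= E a aa.
  have : [set g \o a | a in boundary_seqs beta]%classic (g \o a).
    by rewrite -E; exists a.
  case=> b bb gba; suff <- : b = a by [].
  by apply/funext => i; apply: (can_inj gK); exact: (congr1 (@^~ i) gba).
move=> alpha beta E; apply: boundary_inj; apply/seteqP.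
by split; apply: sub.
Qed.

Lemma cross_difference_isometry o (a b c d : Y) :
  cross_difference o (g a) (g b) (g c) (g d) = cross_difference o a b c d.
Proof. by have [_ gd] := hg; rewrite !cross_differenceE !gd. Qed.

(** Composition with [g] matches the sequences of the points with those of
    their images. It is injective, so the requirement that equal points use the
    same sequence is respected in both directions. *)
Lemma cd_isometry o (alpha beta gamma delta : boundary Y) :
  cd o (boundary_map hg alpha) (boundary_map hg beta)
       (boundary_map hg gamma) (boundary_map hg delta) =
  cd o alpha beta gamma delta.
Proof.
have [[h gK _] _] := hg.
have g_inj : injective (fun a : nat -> Y => g \o a).
  move=> a b ab; apply/funext => i; apply: (can_inj gK).
  exact: (congr1 (@^~ i) ab).
have tnth4 (T U : Type) (f : T -> U) (x y z w : T) k :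
    tnth [tuple f x; f y; f z; f w] k = f (tnth [tuple x; y; z; w] k).
  by rewrite -[RHS](tnth_map f); congr tnth; apply: val_inj.
have limE (a b c d : nat -> Y) :
    limn_einf (fun i => (cross_difference o (g (a i)) (g (b i))
                                            (g (c i)) (g (d i)))%:E) =
    limn_einf (fun i => (cross_difference o (a i) (b i) (c i) (d i))%:E).
  by congr limn_einf; apply/funext => i; rewrite cross_difference_isometry.
congr ereal_sup; apply/funext => t; apply/propext; split.
  case=> _ [_ [_ [_ [[[a aa <-] [b bb <-] [c cc <-] [d dd <-]] eqs ->]]]].
  exists a, b, c, d; split=> // [k l E|]; last exact: limE.
  have := eqs k l.
  rewrite !(tnth4 _ _ (boundary_map hg)) !(tnth4 _ _ (fun a => g \o a)).
  by rewrite E => /(_ erefl)/g_inj.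
case=> a [b [c [d [[aa bb cc dd] eqs ->]]]].
exists (g \o a), (g \o b), (g \o c), (g \o d); split.
- by split; [exists a|exists b|exists c|exists d].
- move=> k l; rewrite !(tnth4 _ _ (boundary_map hg)).
  rewrite !(tnth4 _ _ (fun a => g \o a)).
  by move=> /boundary_map_inj/eqs ->.
- by rewrite -limE.
Qed.

Lemma M_tilde_isometry o P :
  M_tilde o (map_tuple (boundary_map hg) P) = M_tilde o P.
Proof.
by rewrite /M_tilde !tnth_map !cd_isometry !(inj_eq boundary_map_inj).
Qed.

Lemma M_avg_isometry o P :
  M_avg o (map_tuple (boundary_map hg) P) = M_avg o P.
Proof.
apply: eq_mktuple => k; apply: (congr1 (mule _)); apply: eq_bigr => rho _.
by rewrite perm_act_map M_tilde_isometry.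
Qed.

End CanonicalMap.

Theorem mainTheorem3 (R : realType) (Y : metricType R)
    (hY : gromov_hyperbolic Y) :
  [/\ (forall o : Y, sub_moebius (M_avg o)),
      (forall (o o' : Y) (P : 4.-tuple (boundary Y)),
          admissible P -> M_avg o P = M_avg o' P)
    & (forall (o : Y) (g : Y -> Y) (hg : is_isometry g)
              (P : 4.-tuple (boundary Y)),
          admissible P ->
          M_avg o (map_tuple (boundary_map hg) P) = M_avg o P)].
Proof.
split; last 2 first.
- by move=> o o' P _; exact: M_avg_basepoint.
- by move=> o g hg P _; exact: M_avg_isometry.
move=> o.
split=> [P aP|P s aP|P aP|x1 x3 x4 aP].
- have [ndP|/degenerate_coincidence[i [j [ij Pij]]]] :=
      pselect (Defs.nondegenerate P).
    by left; left; left; exact: M_avg_nondegenerate.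
  by rewrite (M_avg_degenerate _ aP ij Pij); exact: inf_vec_L4bar.
- exact: M_avg_perm_act.
- split; last exact: M_avg_nondegenerate.
  move=> L4P; apply: contrapT => /degenerate_coincidence[i [j [ij Pij]]].
  by move: L4P; rewrite (M_avg_degenerate _ aP ij Pij); exact: inf_vec_not_L4.
- rewrite (@M_avg_degenerate _ _ _ _ 0%R 1%R aP) //.
  by rewrite /inf_vec (tnth_nth inf_vec1) /= inordK.
Qed.
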